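(* For every integer $N\ge 0$, $$\det\bigl(uI-C_N(t,s)\bigr)=\prod_{\alpha\in\mathrm{OP}(N)}\bigl(u-r_\alpha(t,s)\bigr),\qquad r_\alpha(t,s)=\prod_{a\in\alpha}\frac{1-t^a}{1-s^a},$$ where $C_N(t,s)$ is the transition matrix between shifted $t$-Schur bases in degree $N$ and the product over $a\in\alpha$ runs over the parts of $\alpha$ with multiplicity. Consequently, $$\det C_N(t,s)=\prod_{\alpha\in\mathrm{OP}(N)}r_\alpha(t,s),\qquad \operatorname{tr}C_N(t,s)=\sum_{\alpha\in\mathrm{OP}(N)}r_\alpha(t,s).$$ Moreover, for fixed $N$, all the matrices $C_N(t,s)$ (for varying parameters) commute with one another.
   Context: A strict partition is a finite sequence $\lambda=(\lambda_1>\cdots>\lambda_\ell>0)$ of integers, with $|\lambda|=\sum\lambda_i$, $\ell(\lambda)=\ell$; $\mathrm{SP}(N)$ is the set of strict partitions of $N$ and $\mathrm{OP}(N)$ the set of partitions of $N$ with all parts odd. Let $\Gamma=\mathbb{Q}[p_1,p_3,p_5,\ldots]$ be the ring of odd power sums, graded by $\deg p_n=n$, with degree-$N$ component $\Gamma_N$. The Schur $Q$-functions $Q_\lambda\in\Gamma$ are defined as follows: $q_r$ is given by $\sum_{r\ge0}q_rz^r=\exp\bigl(2\sum_{n\ge1,\ n\text{ odd}}\frac{p_n}{n}z^n\bigr)$; for $r\ge s\ge0$ let $Q_{(r,s)}=q_rq_s+2\sum_{k=1}^{s}(-1)^kq_{r+k}q_{s-k}$; in general $Q_\lambda$ is the Pfaffian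 of the antisymmetric matrix with entries $Q_{(\lambda_i,\lambda_j)}$ for $i<j$, where a zero part is appended to $\lambda$ if $\ell(\lambda)$ is odd (so $Q_{(r)}=q_r$, $Q_\varnothing=1$). $\{Q_\lambda:\lambda\in\mathrm{SP}(N)\}$ is a basis of $\Gamma_N$. Let $t,s$ be independent indeterminates, with scalars extended to $\mathbb{Q}(t,s)$. Let $T_{t,s}$ be the algebra automorphism of $\Gamma$ (after extension of scalars) with $T_{t,s}(p_n)=\frac{1-t^n}{1-s^n}p_n$ for $n$ odd. (Equivalently $T_{t,s}=\rho_s^{-1}\rho_t$ where $\rho_t(p_n)=(1-t^n)p_n$; the shifted $t$-Schur functions are $\mathcal{Q}_\lambda(X;t)=\rho_tQ_\lambda$.) Define $C_{\lambda\mu}(t,s)$, for $\lambda,\mu\in\mathrm{SP}(N)$, by $T_{t,s}Q_\lambda=\sum_{\mu\in\mathrm{SP}(N)}C_{\lambda\mu}(t,s)Q_\mu$ (equivalently $\mathcal{Q}_\lambda(X;t)=\sum_\mu C_{\lambda\mu}(t,s)\mathcal{Q}_\mu(X;s)$), and let $C_N(t,s)=(C_{\lambda\mu}(t,s))_{\lambda,\mu\in\mathrm{SP}(N)}$, rows and columns in the same fixed order. *)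

(* Defs.v *)
From HB Require Import structures.
From mathcomp Require Import all_boot all_order all_algebra all_fingroup.
From mathcomp Require Import finmap.
From mathcomp.multinomials Require Import monalg.
From Stdlib Require Import ClassicalEpsilon.

Set Implicit Arguments.
Unset Strict Implicit.
Unset Printing Implicit Defensive.

Import GRing.Theory.
Local Open Scope ring_scope.

Definition strict_partition (N : nat) (la : seq nat) : bool :=
  [&& sorted gtn la, 0%N \notin la & sumn la == N].

Definition odd_partition (N : nat) (al : seq nat) : bool :=
  [&& sorted geq al, all odd al & sumn al == N].

(* A partition of N has at most N parts, each at most N, so it is carried by
   the finite type of sequences of length <= N over 'I_N.+1; see SP_onto and
   OP_onto. *)
Definition parts (N : nat) (b : {bseq N of 'I_N.+1}) : seq nat :=
  [seq nat_of_ord i | i <- b].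

Definition SP (N : nat) : {set {bseq N of 'I_N.+1}} :=
  [set b | strict_partition N (parts b)].

Definition OP (N : nat) : {set {bseq N of 'I_N.+1}} :=
  [set b | odd_partition N (parts b)].

Lemma parts_inj N : injective (@parts N).
Proof. by move=> a b /(inj_map val_inj) /val_inj. Qed.

Lemma parts_onto N (la : seq nat) : 0%N \notin la -> sumn la = N ->
  exists b : {bseq N of 'I_N.+1}, parts b = la.
Proof.
move=> la0 laN.
have szla : (size la <= N)%N.
  rewrite -laN; elim: la la0 {laN} => //= x la IH.
  by rewrite inE negb_or eq_sym -lt0n => /andP[x0 /IH]; rewrite -add1n; apply: leq_add.
have lela x : x \in la -> (x < N.+1)%N.
  rewrite ltnS -laN; elim: la {la0 laN szla} => //= y la IH.
  rewrite inE => /orP[/eqP->|/IH h]; first exact: leq_addr.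
  exact: leq_trans h (leq_addl _ _).
have szb : (size [seq inord x : 'I_N.+1 | x <- la] <= N)%N by rewrite size_map.
exists (Bseq szb); rewrite /parts /= -map_comp -[RHS]map_id.
by apply/eq_in_map => x /lela xN /=; rewrite inordK.
Qed.

Lemma SP_onto N la : strict_partition N la ->
  exists2 b, b \in SP N & parts b = la.
Proof.
move=> h; case/and3P: (h) => _ la0 /eqP laN.
by have [b bE] := parts_onto la0 laN; exists b; rewrite // inE bE.
Qed.

Lemma OP_onto N al : odd_partition N al ->
  exists2 b, b \in OP N & parts b = al.
Proof.
move=> h; case/and3P: (h) => _ al_odd /eqP alN.
have al0 : 0%N \notin al by apply/negP => /(allP al_odd).
by have [b bE] := parts_onto al0 alN; exists b; rewrite // inE bE.
Qed.

(* The general term of the rows and columns of C_N, in the order of enum. *)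
Definition sp (N : nat) (i : 'I_#|SP N|) : seq nat := parts (enum_val i).

(* K[p_1, p_3, p_5, ...]: the variable of index k stands for p_(2k+1). *)
Notation Gam K := {malg K[{cmonom nat}]}.

(* Meant for odd n only. *)
Definition p_ (K : fieldType) (n : nat) : Gam K := << ucm n./2 >>.

(* The truncation at order z^r of 2 * \sum_(n odd) p_n / n * z^n. *)
Definition log_q (K : fieldType) (r : nat) : {poly Gam K} :=
  \poly_(n < r.+1) (if odd n then (2 / n%:R : K) *: p_ K n else 0).

(* The coefficient of z^r in exp(F) = \sum_k F^k / k!; since F has no constant
   term, only the terms of F of degree <= r and the powers k <= r matter. *)
Definition q_ (K : fieldType) (r : nat) : Gam K :=
  \sum_(k < r.+1) (k`!%:R : K)^-1 *: (log_q K r ^+ k)`_r.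

(* Meant for r >= s. *)
Definition Q2 (K : fieldType) (r s : nat) : Gam K :=
  q_ K r * q_ K s +
  2 * \sum_(1 <= k < s.+1) (-1) ^+ k * (q_ K (r + k) * q_ K (s - k)).

Definition ord_even (m : nat) (i : 'I_m) : 'I_m.*2 :=
  Ordinal (eq_ind_r is_true (ltn_ord i) (ltn_double i m)).

Definition ord_odd (m : nat) (i : 'I_m) : 'I_m.*2 :=
  Ordinal (eq_ind_r is_true (ltn_ord i) (ltn_Sdouble i m)).

Definition pfaffian (K : fieldType) (A : comAlgType K) (m : nat)
    (M : 'M[A]_(m.*2)) : A :=
  ((2 ^ m * m`!)%:R : K)^-1 *:
    \sum_(w : 'S_(m.*2)) (-1) ^+ w *
      \prod_(i < m) M (w (ord_even i)) (w (ord_odd i)).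

(* nth returns 0 beyond the length of la, which appends the zero part when the
   length is odd. *)
Definition Qmx (K : fieldType) (la : seq nat) :
    'M[Gam K]_((uphalf (size la)).*2) :=
  \matrix_(i, j)
    if (i < j)%N then Q2 K (nth 0%N la i) (nth 0%N la j)
    else if (j < i)%N then - Q2 K (nth 0%N la j) (nth 0%N la i)
    else 0.

Definition schurQ (K : fieldType) (la : seq nat) : Gam K :=
  pfaffian (Qmx K la).

Definition ratio (K : fieldType) (t s : K) (n : nat) : K :=
  (1 - t ^+ n) / (1 - s ^+ n).

Definition Tmon (K : fieldType) (t s : K) (m : {cmonom nat}) : Gam K :=
  \prod_(k <- finsupp m) (ratio t s k.*2.+1 *: p_ K k.*2.+1) ^+ m k.

Definition T_ (K : fieldType) (t s : K) (f : Gam K) : Gam K :=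
  mmap (@malgC {cmonom nat} K) (Tmon t s) f.

Lemma Tmon_mmorphism (K : fieldType) (t s : K) : mmorphism (Tmon t s).
Proof.
pose w k : Gam K := ratio t s k.*2.+1 *: p_ K k.*2.+1.
have TE (m : {cmonom nat}) (d : {fset nat}) : fsubset (finsupp m) d ->
    Tmon t s m = \prod_(k <- d) w k ^+ m k.
  move=> md; rewrite /Tmon (big_fset_incl _ md) // => k _.
  by rewrite -cmE_eq0 => /eqP ->; rewrite expr0.
split=> [m1 m2|]; last by rewrite /Tmon mdom1 big_seq_fset0.
rewrite (TE _ _ (fsubset_refl _)) mdomD (TE m1 _ (fsubsetUl _ (finsupp m2))).
rewrite (TE m2 _ (fsubsetUr (finsupp m1) _)) -big_split /=.
by apply: eq_bigr => k _; rewrite cmM exprD.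
Qed.

HB.instance Definition _ (K : fieldType) (t s : K) :=
  isMultiplicative.Build {cmonom nat} (Gam K) (Tmon t s) (Tmon_mmorphism t s).

Lemma T_M (K : fieldType) (t s : K) : {morph T_ t s : f g / f * g}.
Proof. by move=> f g; rewrite /T_ rmorphM. Qed.

Lemma T_D (K : fieldType) (t s : K) : {morph T_ t s : f g / f + g}.
Proof. by move=> f g; rewrite /T_ mmapD. Qed.

Lemma T_1 (K : fieldType) (t s : K) : T_ t s 1 = 1.
Proof. by rewrite /T_ mmap1. Qed.

Lemma T_p (K : fieldType) (t s : K) n : odd n ->
  T_ t s (p_ K n) = ratio t s n *: p_ K n.
Proof.
move=> n_odd; rewrite /T_ /p_ mmapU /= mpolyC1E mul1r /Tmon mdomU big_seq_fset1.
by rewrite cmUU expr1 /p_ -[in RHS](odd_double_half n) n_odd add1n /= uphalf_double.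
Qed.

Lemma T_Z (K : fieldType) (t s c : K) (f : Gam K) :
  T_ t s (c *: f) = c *: T_ t s f.
Proof. by rewrite /T_ mmapZ /= mul_malgC. Qed.

Definition is_transition (K : fieldType) (N : nat) (t s : K)
    (C : 'M[K]_#|SP N|) : Prop :=
  forall i, T_ t s (schurQ K (sp i)) = \sum_j C i j *: schurQ K (sp j).

(* As the Q_la, la in SP(N), are a basis of the degree N component when K has
   characteristic 0, there is exactly one matrix to choose. *)
Definition C_ (K : fieldType) (N : nat) (t s : K) : 'M[K]_#|SP N| :=
  epsilon (inhabits 0) (is_transition t s).

Definition r_ (K : fieldType) (t s : K) (al : seq nat) : K :=
  \prod_(a <- al) ratio t s a.

(* The field Q(t,s), as the fractions of Q[t][s]. *)
Definition Qts : fieldType := {fraction {poly {poly rat}}}.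
Definition t_ : Qts := tofrac 'X%:P.
Definition s_ : Qts := tofrac 'X.

(* Main.v *)
(* In the basis of products p_al, al in OP(N), the map T_{t,s} is diagonal with
   eigenvalues r_al, and the base change from the Q_la does not involve t and s; hence it
   is enough that the Q_la, la in SP(N), form a basis of the degree N component.
   The series of the q_r satisfies q' = 2 (sum of p_n z^(n-1)) q, which gives q(z) q(-z) = 1,
   i.e. Q_(r,r) = 0 for r > 0. Ordering products of q's by the sum of the squares of their
   indices, Q_la is the product of the q_(la_i) plus higher terms (the Pfaffian of the
   sign matrix is 1), and a product with a repeated index is a combination of higher
   ones; so the Q_la span. Glaisher's map gives #|SP(N)| <= #|OP(N)|. *)
Require Import Defs.
From HB Require Import structures.
From mathcomp Require Import all_boot all_order all_algebra all_fingroup.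
From mathcomp Require Import finmap.
From mathcomp.multinomials Require Import monalg.
From mathcomp Require Import zify ring.
From Stdlib Require Import ClassicalEpsilon.
Import GRing.Theory.
Local Open Scope ring_scope.
Set Implicit Arguments.
Unset Strict Implicit.
Unset Printing Implicit Defensive.

(** * The Pfaffian of the sign matrix *)

(** A permutation of n+1 points amounts to the image [a] of 0 and a permutation of the rest; this
    peels off one row at a time. *)
Lemma sum_perm_lift (R : nzRingType) n (F : 'S_n.+1 -> R) :
  \sum_w F w = \sum_a \sum_(w : 'S_n) F (lift_perm ord0 a w).
Proof.
rewrite pair_big /= (reindex (fun x => lift_perm ord0 x.1 x.2)) //=.
apply: onW_bij; apply: inj_card_bij => [[a v] [b w] /= E|].
  have ab : a = b by rewrite -[a](lift_perm_id ord0 a v) E lift_perm_id.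
  rewrite -{}ab in E *; congr pair; apply/permP => k.
  by apply: (@lift_inj _ a); rewrite -!(lift_perm_lift ord0) E.
by rewrite card_prod !card_Sn card_ord factS.
Qed.

(** Off-diagonal entries of the antisymmetric sign matrix. The value -1 at [i = j] is a default: the
    two indices compared always differ. *)
Definition ordsign (R : nzRingType) (i j : nat) : R := if (i < j)%N then 1 else -1.

(** Since [bump a b] skips [a], the sign is -1 for b < a and 1 from b = a on: twice the alternating
    sum of the first a terms is taken off the full one, which is 1. *)
Lemma sum_sign_row (R : nzRingType) m a :
  (a <= m.*2.+1)%N ->
  \sum_(b < m.*2.+1) (-1) ^+ b * ordsign R a (bump a b) = (-1) ^+ a.
Proof.
move=> am.
have E n : \sum_(b < n) (-1) ^+ b = (odd n)%:R :> R.
  elim: n => [|n IH]; first by rewrite big_ord0.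
  rewrite big_ord_recr /= IH -signr_odd; case: (odd n) => /=.
    by rewrite expr1 subrr.
  by rewrite add0r.
have F b : (-1) ^+ b * ordsign R a (bump a b)
    = (-1) ^+ b - (if (b < a)%N then (-1) ^+ b *+ 2 else 0).
  rewrite /ordsign /bump; case: (leqP a b) => h /=.
    by rewrite add1n ltnS h mulr1 subr0.
  by rewrite add0n ltnNge (ltnW h) /= mulrN1 mulr2n opprD addrA subrr sub0r.
under eq_bigr do rewrite F.
rewrite sumrB E -big_mkcond /= -(big_ord_widen _ (fun b => (-1) ^+ b *+ 2) am).
rewrite sumrMnl E /= odd_double -signr_odd.
by case: (odd a); rewrite ?expr1 ?mul0rn ?subr0 // mulr2n opprD addrA subrr sub0r.
Qed.

Lemma ordsign_lift (R : nzRingType) n (a : 'I_n.+1) (i j : 'I_n) :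
  ordsign R (lift a i) (lift a j) = ordsign R i j.
Proof. by rewrite /ordsign !ltnNge leq_bump2. Qed.

(** This is the Pfaffian 1 of the sign matrix, denominators cleared. With the images of the first
    two indices fixed, the sum over the second gives (-1)^a and cancels the sign of the first, so
    each of the 2(m+1) choices of a contributes the same. *)
Lemma signed_ordsign_sum (R : comNzRingType) m :
  \sum_(w : 'S_(m.*2)) (-1) ^+ w *
    \prod_(i < m) ordsign R (w (ord_even i)) (w (ord_odd i)) = (2 ^ m * m`!)%:R.
Proof.
elim: m => [|m IH].
  under eq_bigr do rewrite big_ord0 mulr1.
  rewrite (big_pred1 1%g) ?odd_perm1 // => w /=.
  by apply/esym/eqP/permP => -[].
rewrite (@sum_perm_lift _ m.*2.+1).
under eq_bigr do rewrite sum_perm_lift.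
have E (a : 'I_m.*2.+2) (b : 'I_m.*2.+1) (w : 'S_(m.*2)) :
   (-1) ^+ (lift_perm ord0 a (lift_perm ord0 b w)) *
     \prod_(i < m.+1) ordsign R (lift_perm ord0 a (lift_perm ord0 b w) (ord_even i))
        (lift_perm ord0 a (lift_perm ord0 b w) (ord_odd i))
   = (-1) ^+ a * ((-1) ^+ b * ordsign R a (bump a b)) *
     ((-1) ^+ w * \prod_(i < m) ordsign R (w (ord_even i)) (w (ord_odd i))).
  rewrite !odd_lift_perm !signr_addb !signr_odd big_ord_recl expr0 !mul1r.
  have -> : ord_even (ord0 : 'I_m.+1) = ord0 by apply: val_inj.
  have -> : ord_odd (ord0 : 'I_m.+1) = lift ord0 ord0 :> 'I_m.*2.+2 by apply: val_inj.
  rewrite lift_perm_id lift_perm_lift lift_perm_id /=.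
  under eq_bigr => i _.
    have -> : ord_even (lift ord0 i) = lift ord0 (lift ord0 (ord_even i)) :> 'I_m.*2.+2.
      by apply: val_inj.
    have -> : ord_odd (lift ord0 i) = lift ord0 (lift ord0 (ord_odd i)) :> 'I_m.*2.+2.
      by apply: val_inj.
    rewrite !lift_perm_lift !ordsign_lift.
    over.
  rewrite -!mulrA; congr (_ * _); rewrite !mulrA; congr (_ * _).
  by rewrite mulrAC [X in X * _ = _]mulrAC.
under eq_bigr => a _.
  under eq_bigr => b _.
    under eq_bigr do rewrite E.
    rewrite -mulr_sumr IH.
    over.
  rewrite -mulr_suml -mulr_sumr sum_sign_row; last first.
    by rewrite -ltnS.
  rewrite -expr2 sqrr_sign mul1r.
  over.
rewrite sumr_const card_ord /= -mulrnA; congr _%:R.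
by rewrite factS expnS -[m.*2.+2]/(m.+1).*2 -mul2n; ring.
Qed.

(** * Truncated exponentials and the relation q(z) q(-z) = 1 *)

Lemma coef_mul_eq (R : nzRingType) (F G F' G' : {poly R}) j :
  (forall i, (i <= j)%N -> F`_i = F'`_i) -> (forall i, (i <= j)%N -> G`_i = G'`_i) ->
  (F * G)`_j = (F' * G')`_j.
Proof.
move=> FF' GG'; rewrite !coefM; apply: eq_bigr => i _.
by rewrite FF' ?GG' ?leq_subr // -ltnS.
Qed.

Lemma coef_exp_eq (R : nzRingType) (F G : {poly R}) k j :
  (forall i, (i <= j)%N -> F`_i = G`_i) -> (F ^+ k)`_j = (G ^+ k)`_j.
Proof.
elim: k j => // k IH j FG; rewrite !exprS; apply: coef_mul_eq => // i ij.
by apply: IH => l li; apply: FG; apply: leq_trans ij.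
Qed.

Lemma coef_exp_lt (R : nzRingType) (F : {poly R}) k j :
  F`_0 = 0 -> (j < k)%N -> (F ^+ k)`_j = 0.
Proof.
move=> F0; elim: k j => // k IH j jk; rewrite exprS coefM big1 // => -[[|i] /= ij] _.
  by rewrite F0 mul0r.
by rewrite IH ?mulr0 //; lia.
Qed.

Lemma natr_neq0 (K : fieldType) n : [pchar K] =i pred0 -> (0 < n)%N -> n%:R != 0 :> K.
Proof. by move=> K0; rewrite (pcharf0P _).1 // lt0n. Qed.

Definition texp (K : fieldType) (A : comAlgType K) n (F : {poly A}) : {poly A} :=
  \sum_(k < n.+1) ((k`!%:R : K)^-1)%:A *: F ^+ k.

Lemma coef_texp (K : fieldType) (A : comAlgType K) n (F : {poly A}) j :
  (texp n F)`_j = \sum_(k < n.+1) (k`!%:R : K)^-1 *: (F ^+ k)`_j.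
Proof. by rewrite coef_sum; apply: eq_bigr => k _; rewrite coefZ mulr_algl. Qed.

(** As (k+1)/(k+1)! = 1/k!, each term differentiates to F' times the preceding one, at the cost of
    one order of truncation. *)
Lemma deriv_texp (K : fieldType) (A : comAlgType K) n (F : {poly A}) :
  [pchar K] =i pred0 -> (texp n.+1 F)^`() = F^`() * texp n F.
Proof.
move=> K0; rewrite /texp big_ord_recl derivD expr0 derivZ (derivC 1) scaler0 add0r.
rewrite raddf_sum mulr_sumr; apply: eq_bigr => k _.
rewrite /= derivZ deriv_exp /= -mulrnAr scalerAr; congr (_ * _).
rewrite -scaler_nat scalerA; congr (_ *: _).
rewrite mulr_algl -[k.+1%:R]scaler_nat scalerA; congr (_ *: _).
by rewrite factS natrM invfM mulrAC mulVf ?mul1r ?natr_neq0.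
Qed.

(* With [Q(z)] and [C(z)] the series of [q] and [c], the hypotheses say [Q' = C Q] and
   [C(-z) = C(z)], so that [Q(z) Q(-z)] has derivative 0. *)
Lemma alternating_sum_of_newton (A : comNzRingType) (c q : nat -> A) :
  (forall n, q n.+1 *+ n.+1 = \sum_(i < n.+1) c i * q (n - i)%N) ->
  (forall i, odd i -> c i = 0) ->
  forall n, (\sum_(k < n.+2) (-1) ^+ k * (q k * q (n.+1 - k)%N)) *+ n.+1 = 0.
Proof.
move=> newton c_odd n.
(* [P], [M] and [C] are Q(z), Q(-z) and C(z), exact up to degree n+1. *)
pose P : {poly A} := \poly_(i < n.+2) q i.
pose M : {poly A} := \poly_(i < n.+2) ((-1) ^+ i * q i).
pose C : {poly A} := \poly_(i < n.+2) c i.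
have -> : \sum_(k < n.+2) (-1) ^+ k * (q k * q (n.+1 - k)%N) = (M * P)`_n.+1.
  rewrite coefM; apply: eq_bigr => i _.
  by rewrite !coef_poly ltn_ord ltnS leq_subr mulrA.
have lt_n2 (k i : nat) : (k <= i)%N -> (i <= n)%N ->
    ((k < n.+2)%N * (i - k < n.+2)%N)%type.
  by move=> ki il; split; lia.
rewrite -coef_deriv derivM coefD.
(* Up to degree n, M' = -C M: the sign change of z is invisible to C, which has only even powers. *)
rewrite (@coef_mul_eq _ M^`() P (- (C * M)) P) //; last first.
  move=> i il; rewrite coef_deriv coefN coefM coef_poly !ltnS il.
  rewrite -mulrnAr newton mulr_sumr -sumrN; apply: eq_bigr => k _.
  have ki : (k <= i)%N by rewrite -ltnS.
  rewrite !coef_poly !(lt_n2 k i) //.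
  have [ko|ke] := boolP (odd k); first by rewrite c_odd // !mul0r mulr0 oppr0.
  have -> : (-1) ^+ i.+1 = - (-1) ^+ (i - k) :> A.
    rewrite exprS mulN1r; congr (- _); rewrite -signr_odd -[RHS]signr_odd oddB //.
    by rewrite (negbTE ke) addbF.
  by rewrite mulNr; congr (- _); rewrite mulrCA.
rewrite (@coef_mul_eq _ M P^`() M (C * P)) //; last first.
  move=> i il; rewrite coef_deriv coefM coef_poly !ltnS il newton.
  apply: eq_bigr => k _.
  have ki : (k <= i)%N by rewrite -ltnS.
  by rewrite !coef_poly !(lt_n2 k i) //.
by rewrite -coefD mulNr mulrCA mulrA addNr coef0.
Qed.

Lemma sum_around_middle (V : nmodType) n (f : nat -> V) :
  \sum_(k < n.*2.+1) f k = f n + \sum_(1 <= k < n.+1) (f (n + k)%N + f (n - k)%N).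
Proof.
rewrite -(big_mkord xpredT f) (@big_cat_nat _ _ _ n) //=; last by lia.
rewrite [X in _ + X]big_ltn; last by lia.
rewrite big_split /= addrCA; congr (_ + _); rewrite addrC; congr (_ + _).
  rewrite -{1}[n.+1]add1n big_addn; apply: congr_big_nat => //; first by lia.
  by move=> k _; rewrite addnC.
rewrite big_nat_rev -[1%N in RHS]add0n big_addn subn1 /=; apply: congr_big_nat => // k _.
by congr (f _); lia.
Qed.

Section Newton.
Variable K : fieldType.
Hypothesis K0 : [pchar K] =i pred0.

Lemma mulrnK (V : lmodType K) n (v : V) : (n.+1%:R : K)^-1 *: (v *+ n.+1) = v.
Proof. by rewrite -scaler_nat scalerA mulVf ?scale1r ?natr_neq0. Qed.

Lemma q_0 : q_ K 0 = 1.
Proof. by rewrite /q_ big_ord1 fact0 invr1 scale1r expr0 coef1. Qed.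

(** The coefficient of z^j sees only the terms of degree at most j and, the constant term being 0,
    only the powers up to j; so all long enough truncations agree. *)
Let coef_texp_q m n j : (j <= m)%N -> (j <= n)%N -> (texp m (log_q K n))`_j = q_ K j.
Proof.
move=> jm jn; rewrite coef_texp /q_; have jm' : (j < m.+1)%N by [].
have E := big_ord_widen m.+1 (fun k => (k`!%:R : K)^-1 *: (log_q K j ^+ k)`_j) jm'.
rewrite {}E [LHS](bigID (fun k : 'I_m.+1 => (k < j.+1)%N)) /= [X in _ + X]big1 ?addr0.
  apply: eq_bigr => k kj; congr (_ *: _).
  apply: coef_exp_eq => i ij; rewrite !coef_poly !ltnS ij.
  by rewrite (leq_trans ij jn).
move=> k; rewrite -ltnNge => kj; rewrite coef_exp_lt ?scaler0 //.
by rewrite coef_poly.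
Qed.

(* The coefficient of [z^n] in [q' = 2 (\sum_(n odd) p_n z^(n-1)) q]. *)
Lemma newton_q n :
  q_ K n.+1 *+ n.+1 = \sum_(i < n.+1) (if odd i then 0 else p_ K i.+1 *+ 2) * q_ K (n - i).
Proof.
rewrite -(@coef_texp_q n.+1 n.+1 n.+1) // -coef_deriv (deriv_texp _ _ K0) coefM.
apply: eq_bigr => i _; congr (_ * _); last first.
  by apply: coef_texp_q; rewrite ?leqW ?leq_subr.
rewrite coef_deriv coef_poly ltnS (ltn_ord i) /=.
case: (odd i) => /=; first by rewrite mul0rn.
by rewrite -scaler_nat scalerA mulrC divfK ?natr_neq0 // scaler_nat.
Qed.

Lemma alternating_q_sum n :
  \sum_(k < n.+2) (-1) ^+ k * (q_ K k * q_ K (n.+1 - k)) = 0.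
Proof.
apply: (can_inj (@mulrnK _ n)); rewrite mul0rn.
pose c i : Gam K := if odd i then 0 else p_ K i.+1 *+ 2.
by apply: (@alternating_sum_of_newton _ c _ newton_q) => i io; rewrite /c io.
Qed.

(** In even total degree 2n the alternating sum, folded around its middle term, is (-1)^n times
    [Q2 K n n]. *)
Lemma Q2_diag r : Q2 K r.+1 r.+1 = 0.
Proof.
have /eqP := alternating_q_sum r.*2.+1; rewrite -[r.*2.+2]/(r.+1.*2).
move: r.+1 => n; rewrite (sum_around_middle n (fun k => (-1) ^+ k * (q_ K k * q_ K (n.*2 - k)))).
have double_sym (A : comNzRingType) (a b x y : A) :
    a * b * (x * y) + a * b * (y * x) = a * (2 * (b * (x * y))) by ring.
have -> : \sum_(1 <= k < n.+1) ((-1) ^+ (n + k) * (q_ K (n + k) * q_ K (n.*2 - (n + k))) +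
      (-1) ^+ (n - k) * (q_ K (n - k) * q_ K (n.*2 - (n - k)))) =
    (-1) ^+ n * (2 * \sum_(1 <= k < n.+1) (-1) ^+ k * (q_ K (n + k) * q_ K (n - k))).
  rewrite !mulr_sumr; apply: eq_big_nat => k /andP[k1 kn].
  have -> : (n.*2 - (n + k) = n - k)%N by lia.
  have -> : (n.*2 - (n - k) = n + k)%N by lia.
  have -> : (-1) ^+ (n - k) = (-1) ^+ (n + k) :> Gam K.
    by rewrite -signr_odd -[RHS]signr_odd oddB ?oddD.
  by rewrite exprD; apply: double_sym.
have -> : (n.*2 - n = n)%N by lia.
rewrite -mulrDr -/(Q2 K n n) => /eqP /(congr1 ( *%R ((-1) ^+ n))).
by rewrite signrMK mulr0.
Qed.
End Newton.

(** * Linear spans *)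

(** An inductive predicate, because the ambient module is infinite-dimensional; coefficients are
    extracted only for finite families, by [lspan_fin]. *)
Inductive lspan (K : fieldType) (V : lmodType K) (S : V -> Prop) : V -> Prop :=
| lspan_gen v of S v : lspan S v
| lspan0 : lspan S 0
| lspanD u v of lspan S u & lspan S v : lspan S (u + v)
| lspanZ a v of lspan S v : lspan S (a *: v).

Section Span.
Variable K : fieldType.

Lemma lspan_sub (V : lmodType K) (S S' : V -> Prop) :
  (forall v, S v -> lspan S' v) -> forall v, lspan S v -> lspan S' v.
Proof.
move=> SS' v; elim=> {v} [v /SS' //||u v _ ? _ ?|a v _ ?].
- exact: lspan0.
- exact: lspanD.
- exact: lspanZ.
Qed.

Lemma lspanN (V : lmodType K) (S : V -> Prop) v : lspan S v -> lspan S (- v).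
Proof. by rewrite -scaleN1r; apply: lspanZ. Qed.

Lemma lspanBr (V : lmodType K) (S : V -> Prop) u v :
  lspan S (u - v) -> lspan S u -> lspan S v.
Proof. by move=> /lspanN uv Su; rewrite -[v](subKr u) -[u - v]opprK opprK; apply: lspanD. Qed.

Lemma lspanBl (V : lmodType K) (S : V -> Prop) u v :
  lspan S (u - v) -> lspan S v -> lspan S u.
Proof. by move=> uv Sv; rewrite -[u](subrK v); apply: lspanD. Qed.

Lemma lspan_sum (V : lmodType K) (S : V -> Prop) (I : Type) (r : seq I) (P : pred I) F :
  (forall i, P i -> lspan S (F i)) -> lspan S (\sum_(i <- r | P i) F i).
Proof. by move=> SF; elim/big_ind: _ => //; [exact: lspan0|exact: lspanD]. Qed.

Lemma lspan_sign (A : algType K) (S : A -> Prop) n u :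
  lspan S u -> lspan S ((-1) ^+ n * u).
Proof.
by rewrite -signr_odd; case: odd => Su; rewrite ?mul1r ?mulN1r //; apply: lspanN.
Qed.

Lemma lspan_mul (A : algType K) (S1 S2 S : A -> Prop) :
  (forall u v, S1 u -> S2 v -> S (u * v)) ->
  forall u v, lspan S1 u -> lspan S2 v -> lspan S (u * v).
Proof.
move=> SS u v Su; elim: Su v => {u} [u Su||u u' _ IH _ IH'|a u _ IH] v Sv.
- elim: Sv => {v} [v Sv||v v' _ IH _ IH'|a v _ IH].
  + exact: lspan_gen (SS _ _ Su Sv).
  + by rewrite mulr0; apply: lspan0.
  + by rewrite mulrDr; apply: lspanD.
  + by rewrite -scalerAr; apply: lspanZ.
- by rewrite mul0r; apply: lspan0.
- by rewrite mulrDl; apply: lspanD; [apply: IH|apply: IH'].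
- by rewrite -scalerAl; apply: lspanZ; apply: IH.
Qed.

Lemma lspan_fin (V : lmodType K) (I : finType) (F : I -> V) v :
  lspan (fun u => exists i, u = F i) v -> exists c : I -> K, v = \sum_i c i *: F i.
Proof.
elim=> {v} [v [i ->]||u v _ [c ->] _ [d ->]|a v _ [c ->]].
- exists (fun j => (j == i)%:R); rewrite (bigD1 i) //= eqxx scale1r big1 ?addr0 // => j.
  by move/negbTE->; rewrite scale0r.
- by exists (fun=> 0); rewrite big1 // => i _; rewrite scale0r.
- exists (fun i => c i + d i); rewrite -big_split; apply: eq_bigr => i _.
  by rewrite scalerDl.
- exists (fun i => a * c i); rewrite scaler_sumr; apply: eq_bigr => i _.
  by rewrite scalerA.
Qed.
End Span.

(** * The filtration by sums of squares *)

Definition sqsum (mu : seq nat) : nat := \sum_(x <- mu) x ^ 2.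

(** This bound in a fixed degree makes straightening terminate. *)
Lemma sqsum_le mu : (sqsum mu <= sumn mu ^ 2)%N.
Proof.
rewrite /sqsum; elim: mu => [|x mu IH] /=; first by rewrite big_nil.
by rewrite big_cons; nia.
Qed.

Section QSpan.
Variables (K : fieldType) (A : comAlgType K) (q : nat -> A).

(** The filtration step of level [s] in degree [n]. The sequences are arbitrary: unsorted, with
    zeros and repetitions allowed. *)
Definition qspan (n s : nat) : A -> Prop :=
  lspan (fun f => exists mu, [/\ sumn mu = n, (s <= sqsum mu)%N & f = \prod_(x <- mu) q x]).

Lemma qspan_le n s s' f : (s' <= s)%N -> qspan n s f -> qspan n s' f.
Proof.
move=> ss'; apply: lspan_sub => _ [mu [mun smu ->]]; apply: lspan_gen.
by exists mu; split=> //; apply: leq_trans smu.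
Qed.

Lemma qspan_gen mu : qspan (sumn mu) (sqsum mu) (\prod_(x <- mu) q x).
Proof. by apply: lspan_gen; exists mu. Qed.

Lemma qspan_mul n s n' s' f f' :
  qspan n s f -> qspan n' s' f' -> qspan (n + n') (s + s') (f * f').
Proof.
apply: lspan_mul => _ _ [mu [<- smu ->]] [nu [<- snu ->]].
exists (mu ++ nu); split; rewrite ?sumn_cat ?big_cat //.
by rewrite /sqsum big_cat leq_add.
Qed.

(** Leading terms multiply: f F - g G = (f - g) F + g (F - G), and each summand lies one level
    higher. *)
Lemma qspan_prod_lead (I : Type) (r : seq I) (d e : I -> nat) (f g : I -> A) :
  (forall i, qspan (d i) (e i) (g i)) ->
  (forall i, qspan (d i) (e i).+1 (f i - g i)) ->
  qspan (\sum_(i <- r) d i) (\sum_(i <- r) e i).+1 (\prod_(i <- r) f i - \prod_(i <- r) g i).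
Proof.
move=> hg hfg.
have hG s : qspan (\sum_(i <- s) d i) (\sum_(i <- s) e i) (\prod_(i <- s) g i).
  elim: s => [|i s IH]; last by rewrite !big_cons; apply: qspan_mul.
  by rewrite !big_nil; have := qspan_gen [::]; rewrite /sqsum !big_nil.
elim: r => [|i r IH]; first by rewrite !big_nil subrr; apply: lspan0.
have hF : qspan (\sum_(i <- r) d i) (\sum_(i <- r) e i) (\prod_(i <- r) f i).
  by apply: lspanBl (hG r); apply: qspan_le IH.
rewrite !big_cons; set F := \prod_(i <- r) f i; set G := \prod_(i <- r) g i.
have -> : f i * F - g i * G = (f i - g i) * F + g i * (F - G) by ring.
apply: lspanD; first by rewrite -addSn; apply: qspan_mul.
by rewrite -addnS; apply: qspan_mul.
Qed.

(** For k > 0, (r+k)^2 + (s-k)^2 exceeds r^2 + s^2 by 2k(r-s) + 2k^2 > 0. *)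
Lemma qspan_sum_straighten r s : (s <= r)%N ->
  qspan (r + s) (r ^ 2 + s ^ 2).+1
    (2 * \sum_(1 <= k < s.+1) (-1) ^+ k * (q (r + k)%N * q (s - k)%N)).
Proof.
move=> sr; rewrite mulr_natl mulr2n; set S := \sum_(_ <= _ < _) _.
suff : qspan (r + s) (r ^ 2 + s ^ 2).+1 S by move=> h; apply: lspanD.
rewrite /S big_nat_cond; apply: lspan_sum => k; rewrite andbT => /andP[k1 ks].
apply: lspan_sign; apply: (@qspan_le _ ((r + k) ^ 2 + (s - k) ^ 2)).
  (* Writing s = k + d and r = k + d + e removes the truncated subtraction. *)
  have [d dE] : exists d, s = (k + d)%N by exists (s - k)%N; lia.
  have [e ->] : exists e, r = (k + d + e)%N by exists (r - s)%N; lia.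
  by rewrite dE addKn !expnS !expn0 !muln1; nia.
apply: lspan_gen; exists [:: (r + k)%N; (s - k)%N].
by rewrite /sqsum !big_cons !big_nil mulr1 /= !addn0; split=> //; lia.
Qed.
End QSpan.

(** * Products over paired indices, padding, sorted sequences *)

Lemma big_even_odd (R : Type) (idx : R) (op : Monoid.law idx) m (F : 'I_m.*2 -> R) :
  \big[op/idx]_(j < m.*2) F j = \big[op/idx]_(i < m) op (F (ord_even i)) (F (ord_odd i)).
Proof.
elim: m F => [|m IH] F; first by rewrite !big_ord0.
rewrite (@big_ord_recl _ _ _ m.*2.+1) (@big_ord_recl _ _ _ m.*2) Monoid.mulmA.
rewrite [RHS]big_ord_recl IH.
congr (op (op _ _) _); first by congr (F _); apply: val_inj.
  by congr (F _); apply: val_inj.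
by apply: eq_bigr => i _; congr (op (F _) (F _)); apply: val_inj.
Qed.

(** The pairs (w(2i), w(2i+1)) run through every index exactly once. *)
Lemma big_perm_even_odd (R : Type) (idx : R) (op : Monoid.com_law idx) m
    (w : 'S_m.*2) (F : 'I_m.*2 -> R) :
  \big[op/idx]_(j < m.*2) F j
    = \big[op/idx]_(i < m) op (F (w (ord_even i))) (F (w (ord_odd i))).
Proof. by rewrite (reindex_inj (@perm_inj _ w)) big_even_odd. Qed.

Lemma big_seq_pad (R : Type) (idx : R) (op : Monoid.law idx) (F : nat -> R) la n :
  F 0%N = idx -> (size la <= n)%N ->
  \big[op/idx]_(i < n) F (nth 0%N la i) = \big[op/idx]_(x <- la) F x.
Proof.
move=> F0 lan; rewrite (big_nth 0%N) -(big_mkord xpredT (fun i => F (nth 0%N la i))).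
rewrite (@big_cat_nat _ _ _ (size la)) //= [X in op _ X]big_nat_cond.
rewrite [X in op _ X]big1 ?Monoid.mulm1 // => i; rewrite andbT => /andP[i1 _].
by rewrite nth_default.
Qed.

(** The case [j = size la] is the appended zero, which lies strictly below every part. *)
Lemma sorted_gtn_nth la i j : sorted gtn la -> 0%N \notin la ->
  (i < j)%N -> (j <= size la)%N -> (nth 0 la j < nth 0 la i)%N.
Proof.
move=> las la0 ij; rewrite leq_eqVlt => /orP[/eqP jE|js].
  have il : (i < size la)%N by rewrite -jE.
  rewrite [nth 0%N la j]nth_default ?jE // lt0n; apply: contraNneq la0 => <-.
  exact: mem_nth.
have := sorted_ltn_nth (rev_trans ltn_trans) 0%N las; apply=> //.
by rewrite inE (ltn_trans ij).
Qed.

Lemma not_uniq_perm (T : eqType) (s : seq T) :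
  ~~ uniq s -> exists x s', perm_eq s [:: x, x & s'].
Proof.
elim: s => //= y s IH; rewrite negb_and negbK => /orP[ys|/IH[x [s' sE]]].
  by exists y, (rem y s); rewrite perm_cons perm_to_rem.
exists x, (y :: s'); rewrite (perm_trans (y := y :: x :: x :: s')) ?perm_cons //.
by have -> := perm_catCA [:: y] [:: x; x] s' [:: x, x, y & s'].
Qed.

(** * The Schur Q-functions span the products of q's *)

Section SchurQ.
Variable K : fieldType.
Hypothesis K0 : [pchar K] =i pred0.

Definition qprod (mu : seq nat) : Gam K := \prod_(x <- mu) q_ K x.

Lemma Q2_lead r s : (s <= r)%N ->
  qspan (q_ K) (r + s) (r ^ 2 + s ^ 2).+1 (Q2 K r s - q_ K r * q_ K s).
Proof.
move=> sr; rewrite /Q2 addrAC subrr add0r.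
exact: (@qspan_sum_straighten K (Gam K) (q_ K)).
Qed.

Lemma qspan_q2 r s : qspan (q_ K) (r + s) (r ^ 2 + s ^ 2) (q_ K r * q_ K s).
Proof.
apply: lspan_gen; exists [:: r; s].
by rewrite /sqsum !big_cons !big_nil mulr1 /= !addn0.
Qed.

Lemma Qmx_lead la (i j : 'I_(uphalf (size la)).*2) :
  sorted gtn la -> 0%N \notin la -> i != j ->
  qspan (q_ K) (nth 0 la i + nth 0 la j)%N (nth 0 la i ^ 2 + nth 0 la j ^ 2).+1
    (Qmx K la i j - ordsign (Gam K) i j * (q_ K (nth 0 la i)%N * q_ K (nth 0 la j)%N)).
Proof.
move=> las la0 ij; rewrite /Qmx mxE /ordsign.
have le_size (k : 'I_(uphalf (size la)).*2) : (k <= size la)%N.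
  by rewrite -ltnS; apply: leq_trans (ltn_ord k) _; rewrite uphalfE; lia.
case: ltngtP => [lij|lji|/val_inj /eqP]; last by rewrite (negbTE ij).
  by rewrite mul1r; apply: Q2_lead; apply/ltnW/sorted_gtn_nth.
rewrite mulN1r -opprD; apply: lspanN.
rewrite (addnC (nth 0%N la i)) (addnC (nth 0%N la i ^ 2)%N) (mulrC (q_ K (nth 0%N la i))).
by apply: Q2_lead; apply/ltnW/sorted_gtn_nth.
Qed.

(** Each permutation pairs up all the parts, so its Pfaffian term leads with a sign times
    [qprod la]; these signs sum to the normalising constant. *)
Lemma schurQ_lead N la : strict_partition N la ->
  qspan (q_ K) N (sqsum la).+1 (schurQ K la - qprod la).
Proof.
case/and3P=> las la0 /eqP laN; rewrite /schurQ /pfaffian.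
set m := uphalf (size la); set c : K := (_ * _)%:R.
have c0 : c != 0.
  by rewrite /c natrM natrX mulf_neq0 ?expf_neq0 ?natr_neq0 ?fact_gt0.
(* The Pfaffian 1 of the sign matrix spreads [qprod la] over the permutations, for a comparison term
   by term. *)
have -> : qprod la = c^-1 *: \sum_(w : 'S_m.*2) (-1) ^+ w *
    \prod_(i < m) ordsign (Gam K) (w (ord_even i)) (w (ord_odd i)) * qprod la.
  rewrite -mulr_suml signed_ordsign_sum -/c mulr_natl -[_ *+ _]scaler_nat scalerA.
  by rewrite mulVf // scale1r.
rewrite -scalerBr -sumrB; apply: lspanZ; apply: lspan_sum => w _.
have len : (size la <= m.*2)%N by rewrite /m; lia.
(* The appended zero must be neutral; this is applied to the q's (as q_0 = 1), to the parts and to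
   their squares. *)
have pad (R : Type) (idx : R) (op : Monoid.com_law idx) (F : nat -> R) : F 0%N = idx ->
    \big[op/idx]_(x <- la) F x = \big[op/idx]_(i < m)
      op (F (nth 0%N la (w (ord_even i)))) (F (nth 0%N la (w (ord_odd i)))).
  by move=> F0; rewrite -(@big_seq_pad _ _ _ _ _ m.*2) // (big_perm_even_odd _ w).
rewrite -mulrA -mulrBr; apply: lspan_sign.
rewrite /qprod (pad _ _ _ (q_ K) (q_0 K)) -big_split /=.
have -> : N = \sum_(i < m) (nth 0 la (w (ord_even i)) + nth 0 la (w (ord_odd i)))%N.
  by rewrite -(pad _ _ _ id) // -laN sumnE.
have -> : sqsum la
    = \sum_(i < m) (nth 0 la (w (ord_even i)) ^ 2 + nth 0 la (w (ord_odd i)) ^ 2)%N.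
  by rewrite -(pad _ _ _ (fun x => x ^ 2)%N).
have ww (i : 'I_m) : w (ord_even i) != w (ord_odd i).
  by rewrite (inj_eq perm_inj) -val_eqE /= neq_ltn ltnSn.
apply: (@qspan_prod_lead K (Gam K)) => i; last exact: Qmx_lead.
rewrite /ordsign; case: ifP => _; first by rewrite mul1r; apply: qspan_q2.
by rewrite mulN1r; apply: lspanN; apply: qspan_q2.
Qed.

Lemma schurQ_qspan N la : strict_partition N la -> qspan (q_ K) N 0 (schurQ K la).
Proof.
move=> laP; apply: lspanBl (qspan_le (leq0n _) (schurQ_lead laP)) _.
apply: (@qspan_le K (Gam K) (q_ K) _ (sqsum la)) => //.
by case/and3P: laP => _ _ /eqP <-; apply: qspan_gen.
Qed.

Definition Qspan N : Gam K -> Prop :=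
  lspan (fun f => exists2 la, strict_partition N la & f = schurQ K la).

(** Since Q_(r+1,r+1) = 0, the square of q_(r+1) is minus its straightening sum, which lies
    higher. *)
Lemma qprod_repeat r mu :
  qspan (q_ K) (sumn (r.+1 :: r.+1 :: mu)) (sqsum (r.+1 :: r.+1 :: mu)).+1
    (qprod (r.+1 :: r.+1 :: mu)).
Proof.
rewrite /qprod /sqsum !big_cons /= [(_ * (_ * _))%R]mulrA (addnA r.+1) (addnA (r.+1 ^ 2)%N) -addSn.
apply: (@qspan_mul K (Gam K)); last exact: qspan_gen.
have := Q2_lead (leqnn r.+1); rewrite (Q2_diag K0) sub0r => /lspanN.
by rewrite opprK.
Qed.

(** Induction on N^2 - [sqsum mu]: with distinct positive indices the product is a Schur Q-function
    up to higher terms, and with a repeated one it is itself a combination of higher terms. *)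
Lemma qprod_Qspan N mu : sumn mu = N -> Qspan N (qprod mu).
Proof.
have [d] := ubnP (N ^ 2 - sqsum mu); elim: d mu => // d IH mu mud muN.
have up f : qspan (q_ K) N (sqsum mu).+1 f -> Qspan N f.
  apply: lspan_sub => _ [nu [nuN munu ->]]; apply: IH => //.
  by have := sqsum_le nu; rewrite nuN; lia.
(* Dropping zeros and sorting changes neither the product, as q_0 = 1, nor the statistic. *)
pose nu := sort geq (filter (leq 1) mu).
have big_nu (R : Type) (idx : R) (op : Monoid.com_law idx) (F : nat -> R) : F 0%N = idx ->
    \big[op/idx]_(x <- nu) F x = \big[op/idx]_(x <- mu) F x.
  move=> F0; rewrite (perm_big (filter (leq 1) mu)) ?perm_sort //=.
  rewrite big_filter [RHS](bigID (leq 1)) /= [X in op _ X]big1 ?Monoid.mulm1 //.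
  by case.
have sum_nu : sumn nu = N by rewrite -muN !sumnE big_nu.
have sq_nu : sqsum nu = sqsum mu by rewrite /sqsum big_nu.
have qprod_nu : qprod nu = qprod mu by apply: big_nu; apply: q_0.
rewrite -qprod_nu -sq_nu -sum_nu in up *.
have nu0 : 0%N \notin nu by rewrite mem_sort mem_filter.
have [nu_uniq|/not_uniq_perm[x [s nuE]]] := boolP (uniq nu).
  have nuP : strict_partition (sumn nu) nu.
    rewrite /strict_partition nu0 eqxx !andbT.
    by rewrite gtn_sorted_uniq_geq nu_uniq /= sort_sorted // => a b; apply: leq_total.
  apply: (@lspanBr _ _ _ (schurQ K nu)); first exact: up (schurQ_lead nuP).
  by apply: lspan_gen; exists nu.
case: x nuE => [|r] nuE; first by rewrite (perm_mem nuE) inE eqxx in nu0.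
have -> : qprod nu = qprod (r.+1 :: r.+1 :: s) by apply: perm_big.
apply: up; rewrite (perm_sumn nuE).
have -> : sqsum nu = sqsum (r.+1 :: r.+1 :: s) by apply: perm_big.
exact: qprod_repeat.
Qed.
End SchurQ.

(** * Glaisher's map from strict to odd partitions *)

(* The number of copies of [m] that the part [a] of a strict partition contributes
   under Glaisher's bijection [2 ^ k * m |-> m, ..., m]. *)
Definition glaisher_mult (m a : nat) : nat :=
  (if a == m * 2 ^ logn 2 a then 2 ^ logn 2 a else 0)%N.

Lemma glaisher_mult_odd m a : odd a -> glaisher_mult m a = (a == m).
Proof.
move=> ao; rewrite /glaisher_mult lognE dvdn2 ao andbF muln1 expn0.
by case: eqP.
Qed.

Lemma glaisher_mult_double m a : (0 < a)%N -> glaisher_mult m a.*2 = (glaisher_mult m a).*2.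
Proof.
move=> a0; rewrite /glaisher_mult -[in logn _ _]muln2 lognM // (pfactorK 1) // addn1 expnS.
by rewrite -mul2n mulnCA eqn_mul2l /=; case: eqP; rewrite ?mul2n.
Qed.

(** An odd part contributes one copy if it is m and none otherwise, and an even part twice what its
    half does; so parity decides whether m is a part. *)
Lemma sum_glaisher_mult_parity m la : uniq la -> 0%N \notin la -> odd m ->
  (\sum_(a <- la) glaisher_mult m a
    = (m \in la) + (\sum_(a <- [seq a./2 | a <- la & ~~ odd a]) glaisher_mult m a).*2)%N.
Proof.
move=> + + mo; elim: la => [|a la IH] /=; first by rewrite !big_nil.
move=> /andP[ala lau]; rewrite !inE negb_or => /andP[a0 la0].
rewrite big_cons IH // eq_sym; have [ao|ae] := boolP (odd a).
  rewrite glaisher_mult_odd // addnA; congr (_ + _)%N.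
  by case: (eqVneq a m) ala => [->|] //= /negbTE->.
rewrite /= big_cons -[in glaisher_mult m a](even_halfK ae) glaisher_mult_double; last by lia.
have /negbTE-> : a != m by apply: contraNneq ae => ->.
by rewrite /=; lia.
Qed.

(** Binary digits are read off one by one: parity of the multiplicities settles the odd parts, and
    the halves of the even parts satisfy the same hypotheses. *)
Lemma glaisher_inj la mu : uniq la -> uniq mu -> 0%N \notin la -> 0%N \notin mu ->
  (forall m, odd m ->
     \sum_(a <- la) glaisher_mult m a = \sum_(a <- mu) glaisher_mult m a)%N ->
  la =i mu.
Proof.
move=> lau muu la0 mu0 E a; have [n] := ubnP a.
elim: n a la mu lau muu la0 mu0 E => // n IH a la mu lau muu la0 mu0 E an.
have uniq_half s : uniq s -> uniq [seq a./2 | a <- s & ~~ odd a].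
  move=> su; rewrite map_inj_in_uniq ?filter_uniq // => x y.
  by rewrite !mem_filter => /andP[xe _] /andP[ye _] /(congr1 double); rewrite !even_halfK.
have mem_half s b : (b \in [seq a./2 | a <- s & ~~ odd a]) = (b.*2 \in s).
  apply/mapP/idP => [[x]|bs]; last first.
    by exists b.*2; rewrite ?doubleK // mem_filter odd_double.
  by rewrite mem_filter => /andP[xe xs] ->; rewrite even_halfK.
have [ao|ae] := boolP (odd a).
  have := E a ao; rewrite (sum_glaisher_mult_parity lau la0 ao).
  rewrite (sum_glaisher_mult_parity muu mu0 ao).
  by move/(congr1 odd); rewrite !oddD !odd_double !addbF; do 2 case: (a \in _).
have [->|a0] := posnP a; first by rewrite (negbTE la0) (negbTE mu0).
rewrite -(even_halfK ae) -!mem_half; apply: IH => //; rewrite ?uniq_half ?mem_half //.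
- move=> m mo; have := E m mo; rewrite (sum_glaisher_mult_parity lau la0 mo).
  rewrite (sum_glaisher_mult_parity muu mu0 mo).
  (* Parity equates the two membership terms; cancelling them and the factor 2 leaves the equality
     for the halves. *)
  move=> H; have := congr1 odd H; rewrite !oddD !odd_double !addbF.
  by move=> P; move: H; rewrite -[m \in la]oddb -[m \in mu]oddb P => /addnI /double_inj.
- by lia.
Qed.

Definition glaisher (la : seq nat) : seq nat :=
  sort geq (flatten [seq nseq (2 ^ logn 2 a) (a %/ 2 ^ logn 2 a)%N | a <- la]).

Lemma perm_glaisher la : perm_eq (glaisher la)
  (flatten [seq nseq (2 ^ logn 2 a) (a %/ 2 ^ logn 2 a)%N | a <- la]).
Proof. by rewrite perm_sort. Qed.

Lemma glaisher_odd_partition N la : strict_partition N la -> odd_partition N (glaisher la).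
Proof.
case/and3P=> _ la0 /eqP <-; apply/and3P; split.
- by apply: sort_sorted => a b; apply: leq_total.
- rewrite all_sort; apply/allP => x /flatten_mapP[a ala]; rewrite mem_nseq => /andP[_ /eqP->].
  have a0 : (0 < a)%N by rewrite lt0n; apply: contraNneq la0 => <-.
  have [m mo aE] := @pfactor_coprime 2 a isT a0.
  by rewrite {1}aE mulnK ?expn_gt0 // -coprime2n.
apply/eqP; rewrite (perm_sumn (perm_glaisher la)).
rewrite sumn_flatten -map_comp; congr sumn; rewrite -[RHS]map_id; apply: eq_map => a /=.
by rewrite sumn_nseq divnK // pfactor_dvdnn.
Qed.

Lemma count_glaisher m la :
  count_mem m (glaisher la) = \sum_(a <- la) glaisher_mult m a.
Proof.
rewrite (seq.permP (perm_glaisher la)).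
rewrite count_flatten -map_comp sumnE big_map; apply: eq_bigr => a _ /=.
rewrite count_nseq /glaisher_mult /= [_ == m]eq_sym eqn_div ?expn_gt0 ?pfactor_dvdnn //.
rewrite [in RHS]eq_sym.
by case: eqP; rewrite ?mul1n ?mul0n.
Qed.

Lemma card_SP_le_OP N : (#|SP N| <= #|OP N|)%N.
Proof.
(* The default [b] is never taken on [SP N], where the image is an odd partition of N. *)
pose g (b : {bseq N of 'I_N.+1}) := odflt b [pick b' | parts b' == glaisher (parts b)].
have gE b : b \in SP N -> parts (g b) = glaisher (parts b).
  rewrite inE => /glaisher_odd_partition /OP_onto[b' _ b'E].
  by rewrite /g; case: pickP => [? /eqP //|/(_ b')]; rewrite b'E eqxx.
rewrite -(@card_in_imset _ _ g); last first.
  move=> b c bS cS /(congr1 (@parts N)); rewrite !gE // => bc.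
  move: bS cS; rewrite !inE => /and3P[bs b0 _] /and3P[cs c0 _].
  apply: parts_inj; apply: (irr_sorted_eq (rev_trans ltn_trans)) => //.
    by move=> x; apply: ltnn.
  move: (bs) (cs); rewrite !gtn_sorted_uniq_geq => /andP[bu _] /andP[cu _].
  by apply: glaisher_inj => // m _; rewrite -!count_glaisher bc.
apply/subset_leq_card/subsetP => _ /imsetP[b bS ->].
rewrite inE gE //; apply: glaisher_odd_partition.
by rewrite inE in bS.
Qed.

(** * Power-sum products: independence, eigenvalues, spans *)

Section PowerSums.
Variable K : fieldType.

Definition pprod (al : seq nat) : Gam K := \prod_(a <- al) p_ K a.

(** An odd part a is the variable of index [a./2], as p_(2k+1) has index k. *)
Definition pmonom (al : seq nat) : {cmonom nat} :=
  foldr (fun a m => mmul (ucm a./2) m) mone al.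

Lemma pmonomE al k : pmonom al k = count (fun a => a./2 == k) al.
Proof.
elim: al => [|a al IH] /=; first exact: cm1.
by rewrite [LHS]cmM IH cmU.
Qed.

(** An odd x is recovered from [x./2], so the exponents are the multiplicities of the parts, which
    determine a sorted sequence. *)
Lemma pmonom_inj al be : all odd al -> all odd be -> sorted geq al -> sorted geq be ->
  pmonom al = pmonom be -> al = be.
Proof.
move=> alo beo als bes E; apply: (sorted_eq _ _ als bes).
- by move=> x y z /= yx zy; apply: leq_trans zy yx.
- by move=> x y /andP[xy yx]; apply/eqP; rewrite eqn_leq; apply/andP.
have cnt (s : seq nat) x : all odd s -> odd x -> count_mem x s = pmonom s x./2.
  move=> so xo; rewrite pmonomE; apply: eq_in_count => y ys /=.
  have yo := allP so y ys; apply/eqP/eqP => [-> //|].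
  by rewrite -{2}(odd_double_half x) -{2}(odd_double_half y) xo yo => ->.
apply/allP => x; rewrite mem_cat => xab; apply/eqP.
have xo : odd x by case/orP: xab => [/(allP alo)|/(allP beo)].
by rewrite /= !cnt // E.
Qed.

Lemma malg1M (k l : {cmonom nat}) : << k >> * << l >> = << mmul k l >> :> Gam K.
Proof. by rewrite malgM_def fgmulUU mul1r. Qed.

Lemma pprodE al : pprod al = << pmonom al >>.
Proof.
rewrite /pprod; elim: al => [|a al IH]; first by rewrite big_nil /= mpolyC1E.
by rewrite big_cons IH; apply: malg1M.
Qed.

(** Distinct odd partitions give distinct monomials, so coefficients can be read off: this is linear
    independence. *)
Lemma mcoeff_sum_pprod (I : finType) (al : I -> seq nat) (c : I -> K) i :
  (forall j, sorted geq (al j) && all odd (al j)) -> injective al ->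
  mcoeff (pmonom (al i)) (\sum_j c j *: pprod (al j)) = c i.
Proof.
move=> alP al_inj; rewrite raddf_sum (bigD1 i) //= big1 ?addr0.
  by rewrite mcoeffZ pprodE mcoeffUU mulr1.
move=> j ji; rewrite mcoeffZ pprodE mcoeffU.
have [/pmonom_inj E|_] := eqVneq; last by rewrite mulr0.
have /andP[? ?] := alP i; have /andP[? ?] := alP j.
by rewrite (al_inj _ _ (E _ _ _ _)) ?eqxx in ji.
Qed.

Lemma T_pprod t s al : all odd al -> T_ t s (pprod al) = r_ t s al *: pprod al.
Proof.
rewrite /pprod /r_; elim: al => [|a al IH] /=; first by rewrite !big_nil T_1 scale1r.
case/andP=> ao alo; rewrite !big_cons T_M T_p // IH //.
by rewrite -scalerAl -scalerAr scalerA.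
Qed.

Hypothesis K0 : [pchar K] =i pred0.

Definition pspan (n : nat) : Gam K -> Prop :=
  lspan (fun f => exists2 al, all odd al && (sumn al == n) & f = pprod al).

Lemma pspan_mul n n' f f' : pspan n f -> pspan n' f' -> pspan (n + n') (f * f').
Proof.
apply: (@lspan_mul K (Gam K)) => _ _ [al /andP[alo /eqP<-] ->] [be /andP[beo /eqP<-] ->].
exists (al ++ be); rewrite ?all_cat ?alo ?beo ?sumn_cat ?eqxx //.
by rewrite /pprod big_cat.
Qed.

Lemma pspan_gen al : all odd al -> pspan (sumn al) (pprod al).
Proof. by move=> alo; apply: lspan_gen; exists al; rewrite ?alo /=. Qed.

Lemma pspan_p n : odd n -> pspan n (p_ K n).
Proof.
by move=> no; have := @pspan_gen [:: n]; rewrite /pprod big_seq1 /= no addn0; apply.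
Qed.

(** Strong induction on Newton's identity, divided by n+1. *)
Lemma pspan_q n : pspan n (q_ K n).
Proof.
elim/ltn_ind: n => -[|n] IH.
  by rewrite q_0; have := @pspan_gen [::] isT; rewrite /pprod big_nil.
rewrite -(mulrnK K0 n (q_ K n.+1)).
rewrite newton_q //; apply: lspanZ; apply: lspan_sum => -[i le_in] _ /=.
have [io|ie] := boolP (odd i); first by rewrite mul0r; apply: lspan0.
have -> : n.+1 = (i.+1 + (n - i))%N by rewrite addSn subnKC.
apply: pspan_mul; last by apply: IH; rewrite ltnS leq_subr.
by rewrite mulr2n; apply: lspanD; apply: pspan_p.
Qed.

Lemma qspan_pspan n s f : qspan (q_ K) n s f -> pspan n f.
Proof.
apply: lspan_sub => _ [mu [<- _ ->]].
elim: mu => [|x mu IH]; last by rewrite big_cons; apply: pspan_mul => //; apply: pspan_q.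
by rewrite big_nil; have := @pspan_gen [::] isT; rewrite /pprod big_nil.
Qed.

(** Newton's identity is solved for 2 p_(n+1), its last summand since q_0 = 1; the other power sums
    in it have smaller index. *)
Lemma qspan_p n : odd n -> qspan (q_ K) n 0 (p_ K n).
Proof.
elim/ltn_ind: n => -[|n] // IH no.
have E : q_ K n.+1 *+ n.+1 =
    \sum_(i < n) (if odd i then 0 else p_ K i.+1 *+ 2) * q_ K (n - i) + p_ K n.+1 *+ 2.
  rewrite newton_q // big_ord_recr /= subnn q_0 (negbTE (no : ~~ odd n)).
  by congr (_ + _); apply: mulr1.
rewrite -(mulrnK K0 1 (p_ K n.+1)).
apply: lspanZ.
set S := \sum_(_ < _) _ in E.
have -> : p_ K n.+1 *+ 2 = (n.+1%:R : K) *: q_ K n.+1 - S.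
  by apply/esym/eqP; rewrite subr_eq addrC -E; apply/eqP; apply: scaler_nat.
apply: lspanD.
  apply: lspanZ; apply: lspan_gen; exists [:: n.+1].
  by rewrite big_seq1 /= addn0.
apply: lspanN; apply: lspan_sum => -[i le_in] _ /=.
have [io|ie] := boolP (odd i); first by rewrite mul0r; apply: lspan0.
have -> : n.+1 = (i.+1 + (n - i))%N by rewrite addSn subnKC // ltnW.
rewrite -[0%N]/(0 + 0)%N; apply: (@qspan_mul K (Gam K)).
  have hi : qspan (q_ K) i.+1 0 (p_ K i.+1) by apply: IH => //; rewrite ltnS.
  by rewrite mulr2n; apply: lspanD.
apply: lspan_gen; exists [:: (n - i)%N].
by rewrite big_seq1 /= addn0.
Qed.

Lemma qspan_pprod al : all odd al -> qspan (q_ K) (sumn al) 0 (pprod al).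
Proof.
rewrite /pprod; elim: al => [_|a al IH /= /andP[ao alo]].
  by rewrite big_nil; apply: lspan_gen; exists [::]; rewrite big_nil.
rewrite big_cons -[0%N]/(0 + 0)%N; apply: (@qspan_mul K (Gam K)); last exact: IH.
exact: qspan_p.
Qed.
End PowerSums.

(** * Base change and diagonalization of the transition matrix *)

Definition op (N : nat) (j : 'I_#|OP N|) : seq nat := parts (enum_val j).

Lemma opP N (j : 'I_#|OP N|) : odd_partition N (op j).
Proof. by have := enum_valP j; rewrite inE. Qed.

Lemma op_inj N : injective (@op N).
Proof. by move=> i j /parts_inj /enum_val_inj. Qed.

Lemma op_onto N al : odd_partition N al -> exists j : 'I_#|OP N|, al = op j.
Proof.
by case/OP_onto=> b bO <-; exists (enum_rank_in bO b); rewrite /op enum_rankK_in.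
Qed.

Lemma spP N (i : 'I_#|SP N|) : strict_partition N (sp i).
Proof. by have := enum_valP i; rewrite inE. Qed.

Lemma sp_onto N la : strict_partition N la -> exists i : 'I_#|SP N|, la = sp i.
Proof.
by case/SP_onto=> b bO <-; exists (enum_rank_in bO b); rewrite /sp enum_rankK_in.
Qed.

Lemma T_sum (K : fieldType) (t s : K) (I : Type) (r : seq I) (P : pred I) F :
  T_ t s (\sum_(i <- r | P i) F i) = \sum_(i <- r | P i) T_ t s (F i).
Proof.
by apply: (big_morph (T_ t s) (T_D t s)); rewrite -[0](scale0r 0) T_Z !scale0r.
Qed.

Lemma sum_scale_mulmx (K : fieldType) (V : lmodType K) m n p
    (X : 'M[K]_(m, n)) (Y : 'M[K]_(n, p)) (v : 'I_p -> V) i :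
  \sum_k (X *m Y) i k *: v k = \sum_j X i j *: \sum_k Y j k *: v k.
Proof.
under [RHS]eq_bigr do rewrite scaler_sumr.
rewrite exchange_big; apply: eq_bigr => k _; rewrite mxE scaler_suml.
by apply: eq_bigr => j _; rewrite scalerA.
Qed.

Lemma sum_scale_mx1 (K : fieldType) (V : lmodType K) p (v : 'I_p -> V) i :
  \sum_j (1%:M : 'M[K]_p) i j *: v j = v i.
Proof.
rewrite (bigD1 i) //= mxE eqxx scale1r big1 ?addr0 // => j ji.
by rewrite mxE eq_sym (negbTE ji) scale0r.
Qed.

(** The two sizes are equal but not convertible, so the equality is eliminated first. *)
Lemma mulmx1C_cast (K : fieldType) m n (A : 'M[K]_(m, n)) (B : 'M[K]_(n, m)) :
  m = n -> A *m B = 1%:M -> B *m A = 1%:M.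
Proof. by move=> mn; case: n / mn A B => A B; apply: mulmx1C. Qed.

Section Transition.
Variables (K : fieldType) (N : nat).
Hypothesis K0 : [pchar K] =i pred0.

Lemma schurQ_in_pprod (i : 'I_#|SP N|) :
  exists c : 'I_#|OP N| -> K, schurQ K (sp i) = \sum_j c j *: pprod K (op j).
Proof.
apply: lspan_fin; have := qspan_pspan K0 (schurQ_qspan K0 (spP i)).
apply: lspan_sub => _ [al /andP[alo /eqP alN] ->]; apply: lspan_gen.
have [|j jE] := @op_onto N (sort geq al).
  rewrite /odd_partition all_sort alo sort_sorted; last by move=> a b; apply: leq_total.
  by rewrite (perm_sumn (_ : perm_eq _ al)) ?perm_sort // alN eqxx.
by exists j; rewrite -jE /pprod; apply: perm_big; rewrite perm_sym perm_sort.
Qed.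

Lemma pprod_in_schurQ (j : 'I_#|OP N|) :
  exists c : 'I_#|SP N| -> K, pprod K (op j) = \sum_i c i *: schurQ K (sp i).
Proof.
apply: lspan_fin; have /and3P[_ jo /eqP jN] := opP j.
have := qspan_pprod K0 jo; rewrite jN; apply: lspan_sub => _ [mu [muN _ ->]].
have := qprod_Qspan K0 muN; apply: lspan_sub => _ [la /sp_onto[i ->] ->].
by apply: lspan_gen; exists i.
Qed.

Lemma pprod_comb_inj m (X Y : 'M[K]_(m, #|OP N|)) :
  (forall i, \sum_j X i j *: pprod K (op j) = \sum_j Y i j *: pprod K (op j)) -> X = Y.
Proof.
move=> XY; apply/matrixP => i k.
have opP' (j : 'I_#|OP N|) : sorted geq (op j) && all odd (op j).
  by have /and3P[-> ->] := opP j.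
have coefX := mcoeff_sum_pprod (X i) k opP' (@op_inj N).
have coefY := mcoeff_sum_pprod (Y i) k opP' (@op_inj N).
exact: etrans (esym coefX) (etrans (congr1 (mcoeff (pmonom (op k))) (XY i)) coefY).
Qed.

(** [A] and [B] express the Schur Q-functions and the power-sum products through each other. They
    are chosen before t and s, so one pair diagonalizes all the transition matrices. *)
Lemma C_diagonalization :
  exists (A : 'M[K]_(#|SP N|, #|OP N|)) (B : 'M[K]_(#|OP N|, #|SP N|)),
    [/\ A *m B = 1%:M, B *m A = 1%:M &
      forall t s, C_ N t s = A *m diag_mx (\row_j r_ t s (op j)) *m B].
Proof.
have [c cP] := fin_all_exists schurQ_in_pprod.
have [d dP] := fin_all_exists pprod_in_schurQ.
pose A := \matrix_(i, j) c i j; pose B := \matrix_(j, i) d j i.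
have AP i : schurQ K (sp i) = \sum_j A i j *: pprod K (op j).
  by rewrite cP; apply: eq_bigr => j _; rewrite mxE.
have BP j : pprod K (op j) = \sum_i B j i *: schurQ K (sp i).
  by rewrite dP; apply: eq_bigr => i _; rewrite mxE.
have combA m (X : 'M_(m, _)) i :
    \sum_j X i j *: schurQ K (sp j) = \sum_j (X *m A) i j *: pprod K (op j).
  by rewrite sum_scale_mulmx; apply: eq_bigr => k _; rewrite AP.
have BA : B *m A = 1%:M.
  apply: pprod_comb_inj => i.
  have P1 := sum_scale_mx1 (fun j => pprod K (op j)) i.
  exact: etrans (esym (combA _ B i)) (etrans (esym (BP i)) (esym P1)).
(* [BA] bounds the number of odd partitions by that of strict ones; Glaisher's map gives the
   converse bound. *)
have card_eq : #|OP N| = #|SP N|.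
  by apply/eqP; rewrite eqn_leq (mulmx1_min BA) card_SP_le_OP.
have AB := mulmx1C_cast card_eq BA.
exists A, B; split=> // t s; set D := diag_mx _.
(* Coefficients are compared in the power-sum products, where T is diagonal. *)
have transE (C : 'M_#|SP N|) : is_transition t s C <-> C *m A = A *m D.
  have TA i : T_ t s (schurQ K (sp i)) = \sum_j (A *m D) i j *: pprod K (op j).
    rewrite AP T_sum; apply: eq_bigr => j _.
    rewrite T_Z T_pprod; last by have /and3P[] := opP j.
    by rewrite mul_mx_diag !mxE scalerA.
  split=> [CP|CA i]; last by rewrite TA combA CA.
  apply: pprod_comb_inj => i.
  exact: etrans (esym (combA _ C i)) (etrans (esym (CP i)) (TA i)).
(* The matrix A D B witnesses existence, so the chosen matrix is a transition matrix too. *)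
have : is_transition t s (C_ N t s).
  apply: epsilon_spec; exists (A *m D *m B); apply/transE.
  by rewrite -mulmxA BA mulmx1.
by move/transE <-; rewrite -mulmxA AB mulmx1.
Qed.
End Transition.

(** * Similarity invariants and the conclusion *)

(** The two inverse identities force m = n, so that A and B have determinants; these cancel after
    conjugating uI - D. *)
Lemma char_poly_similar (K : fieldType) m n (A : 'M[K]_(m, n)) B (D : 'M[K]_n) :
  A *m B = 1%:M -> B *m A = 1%:M -> char_poly (A *m D *m B) = char_poly D.
Proof.
move=> AB BA; have nm : n = m by apply/eqP; rewrite eqn_leq (mulmx1_min BA) (mulmx1_min AB).
case: m / nm A B AB BA => A B AB BA.
pose P (M : 'M[K]_n) := map_mx (@polyC K) M.
have PAB : P A *m P B = 1%:M by rewrite -map_mxM AB map_mx1.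
rewrite /char_poly; have -> : char_poly_mx (A *m D *m B) = P A *m char_poly_mx D *m P B.
  rewrite /char_poly_mx mulmxBr mulmxBl !map_mxM scalar_mxC -[_ *m P A *m P B]mulmxA.
  by rewrite PAB mulmx1.
by rewrite !det_mulmx mulrAC -det_mulmx PAB det1 mul1r.
Qed.

Lemma det_similar (K : fieldType) m n (A : 'M[K]_(m, n)) B (D : 'M[K]_n) :
  A *m B = 1%:M -> B *m A = 1%:M -> \det (A *m D *m B) = \det D.
Proof.
move=> AB BA; have nm : n = m by apply/eqP; rewrite eqn_leq (mulmx1_min BA) (mulmx1_min AB).
case: m / nm A B AB BA => A B AB BA.
by rewrite !det_mulmx mulrAC -det_mulmx AB det1 mul1r.
Qed.

Lemma pchar_Qts : [pchar Qts] =i pred0.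
Proof.
apply/pcharf0P => n; rewrite -[n%:R](rmorph_nat (@tofrac {poly {poly rat}})).
by rewrite tofrac_eq0 -!polyC_natr !polyC_eq0 Num.Theory.pnatr_eq0.
Qed.

Theorem theorem3p3 (N : nat) :
  [/\ char_poly (C_ N t_ s_)
        = \prod_(al in OP N) ('X - (r_ t_ s_ (parts al))%:P),
      \det (C_ N t_ s_) = \prod_(al in OP N) r_ t_ s_ (parts al),
      \tr (C_ N t_ s_) = \sum_(al in OP N) r_ t_ s_ (parts al)
    & forall (K : fieldType) (t s t' s' : K),
        [pchar K] =i pred0 ->
        (forall n, odd n -> s ^+ n != 1) ->
        (forall n, odd n -> s' ^+ n != 1) ->
        C_ N t s *m C_ N t' s' = C_ N t' s' *m C_ N t s].
Proof.
split; last first.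
  (* The same [A] and [B] serve both pairs of parameters, and diagonal matrices commute. *)
  move=> K t s t' s' K0 _ _; have [A [B [AB BA CE]]] := C_diagonalization N K0.
  rewrite !CE -!mulmxA ![B *m (A *m _)]mulmxA BA !mul1mx ![diag_mx _ *m (_ *m _)]mulmxA.
  by rewrite diag_mxC.
all: have [A [B [AB BA CE]]] := C_diagonalization N pchar_Qts; rewrite CE.
- rewrite mxtrace_mulC mulmxA BA mul1mx mxtrace_diag [RHS]big_enum_val.
  by apply: eq_bigr => j _; rewrite mxE.
- rewrite (det_similar _ AB BA) det_diag [RHS]big_enum_val.
  by apply: eq_bigr => j _; rewrite mxE.
rewrite (char_poly_similar _ AB BA) char_poly_trig ?diag_mx_is_trig // [RHS]big_enum_val.
by apply: eq_bigr => j _; rewrite !mxE eqxx.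
Qed.
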